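(* There exists an infinite family of strings, containing strings of arbitrarily large length $n$, and a constant $C>0$ such that every string $w$ of length $n\ge 2$ in the family satisfies $\ell(w) \ge C\,\delta(w)\log n$; that is, $\ell = \Omega(\delta\log n)$ on this family.
   Context: For a string $w[1,n]$, let $S_w(k)$ be the number of distinct substrings of length $k$ of $w$, and $\delta(w) = \max\{S_w(k)/k : 1\le k\le n\}$. L-system: a tuple $L=(V,R,S,\tau,d,n)$ where $V$ is a finite set of variables, $R: V\to V^+$ assigns to each variable a nonempty string (extended homomorphically to strings), $S\in V^*$ is the axiom, $\tau: V\to V$ is a coding (letter-to-letter map, extended homomorphically), $d\in\mathbb{N}$ and $n\in\mathbb{N}$. Its levels are $L_0=S$ and $L_{i+1}=R(L_i)$; it generates the string $w[1,n]=\tau(L_d[1,n])$. Its size is $|S|+\sum_{A\in V}|R(A)|$. $\ell(w)$ is the size of the smallest L-system generating $w$. *)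

(* Defs.v *)
From HB Require Import structures.
From mathcomp Require Import all_boot all_order all_algebra.
From mathcomp Require Import finmap.
From mathcomp Require Import boolp classical_sets cardinality reals exp.

Set Implicit Arguments.
Unset Strict Implicit.
Unset Printing Implicit Defensive.

Import Order.TTheory GRing.Theory Num.Theory.

Local Open Scope ring_scope.

(* Symbols are natural numbers: a countably infinite supply from which every
   string takes its letters and every L-system its finite set of variables. *)
Definition str := seq nat.

(* For k > size w the range of starting positions is empty. *)
Definition substrings (w : str) (k : nat) : seq str :=
  [seq take k (drop i w) | i <- iota 0 ((size w).+1 - k)].

Definition nb_substrings (w : str) (k : nat) : nat :=
  size (undup (substrings w k)).

(* The default 0 of the maximum is harmless, all quotients being
   nonnegative. *)
Definition delta (R : realType) (w : str) : R :=
  \big[Num.max/0]_(1 <= k < (size w).+1) ((nb_substrings w k)%:R / k%:R).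

(* `ls_vars L` is also the finite type of its elements, so that the rules, the
   axiom and the coding stay within the variables by typing. *)
Record lsystem := LSystem {
  ls_vars : {fset nat};
  ls_rule : ls_vars -> seq ls_vars;
  ls_rule_neq0 : forall A : ls_vars, ls_rule A != [::];
  ls_axiom : seq ls_vars;
  ls_coding : ls_vars -> ls_vars;
  ls_depth : nat;
  ls_length : nat
}.

Definition ls_step (L : lsystem) (s : seq (ls_vars L)) : seq (ls_vars L) :=
  flatten [seq ls_rule A | A <- s].

Definition ls_level (L : lsystem) (i : nat) : seq (ls_vars L) :=
  iter i (@ls_step L) (ls_axiom L).

(* The size condition makes the prefix of length `ls_length L` meaningful. *)
Definition generates (L : lsystem) (w : str) : Prop :=
  (ls_length L <= size (ls_level L (ls_depth L)))%N /\
  w = [seq val (ls_coding A)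
      | A <- take (ls_length L) (ls_level L (ls_depth L))].

Definition ls_size (L : lsystem) : nat :=
  (size (ls_axiom L) + \sum_(A : ls_vars L) size (ls_rule A))%N.

Lemma generating_size_exists (w : str) :
  exists s, `[< exists2 L, generates L w & ls_size L = s >].
Proof.
pose V : {fset nat} := [fset x in w]%fset.
pose S : seq V := pmap insub w.
have valS : map val S = w.
  rewrite (pmap_filter (@insubK _ _ V)); apply/all_filterP/allP => x xw.
  by rewrite isSome_insub /V !inE.
pose L := @LSystem V (fun A => [:: A]) (fun A => isT) S id 0 (size S).
exists (ls_size L); apply/asboolP; exists L => //.
by split; rewrite /ls_level /= ?take_size.
Qed.

Definition ell (w : str) : nat := ex_minn (generating_size_exists w).

(* Main.v *)
Require Import Defs.
From HB Require Import structures.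
From mathcomp Require Import all_boot all_order all_algebra.
From mathcomp Require Import finmap.
From mathcomp Require Import boolp classical_sets cardinality reals exp.
From mathcomp Require Import zify ring.

Set Implicit Arguments.
Unset Strict Implicit.
Unset Printing Implicit Defensive.

Import Order.TTheory GRing.Theory Num.Theory.

Local Open Scope nat_scope.

(* A counting argument. There are 2 ^ (k (k - 1)) binary words of length
   n = 4 ^ k with one 1 in each interval [4 ^ i, 2 * 4 ^ i), i < k, and 0
   elsewhere. All have delta <= 3: beyond position l, a window of length l sees
   at most one 1. On the other hand, L-systems of size at most k generate only
   2 ^ O(k log k) words of length n, so for large k some of these words have
   ell > k = log_4 n.

   The depth d is free of charge in the size of an L-system, so it has to be
   bounded. Let N = k!, so that the N-th iterate of any self-map of the
   variables is idempotent. Then the prefixes of length j of levels j N and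
   (j + 1) N agree, by induction on j, so the prefix of length n is N-periodic
   in d from d = n N on. *)

(** * Iterated non-erasing substitutions and their depth *)

Definition subst (T : Type) (r : T -> seq T) (u : seq T) : seq T :=
  flatten (map r u).

Section Substitution.

Variables (T : Type) (r : T -> seq T).

Lemma subst_cat (u v : seq T) : subst r (u ++ v) = subst r u ++ subst r v.
Proof. by rewrite /subst map_cat flatten_cat. Qed.

Lemma iter_subst_cat (d : nat) (u v : seq T) :
  iter d (subst r) (u ++ v) = iter d (subst r) u ++ iter d (subst r) v.
Proof. by elim: d => //= d ->; rewrite subst_cat. Qed.

Lemma map_iter_subst (T' : Type) (r' : T' -> seq T') (f : T -> T') :
  (forall x, r' (f x) = map f (r x)) ->
  forall (d : nat) (u : seq T),
  map f (iter d (subst r) u) = iter d (subst r') (map f u).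
Proof.
move=> rf d u; elim: d => //= d <-.
by rewrite /subst map_flatten -!map_comp; congr flatten; apply: eq_map => x /=.
Qed.

Hypothesis r_neq0 : forall x, 0 < size (r x).

Lemma size_subst (u : seq T) : size u <= size (subst r u).
Proof.
elim: u => //= x u IHu; rewrite /subst /= size_cat -add1n.
exact: leq_add.
Qed.

Lemma size_iter_subst (d : nat) (u : seq T) :
  size u <= size (iter d (subst r) u).
Proof. by elim: d => //= d /leq_trans; apply; apply: size_subst. Qed.

(** No letter is erased, so the images of the first [n] letters already fill the first [n] places of
    every later level. *)
Lemma take_iter_subst (n d : nat) (u : seq T) :
  take n (iter d (subst r) (take n u)) = take n (iter d (subst r) u).
Proof.
have [le_un|lt_nu] := leqP (size u) n; first by rewrite (take_oversize le_un).
rewrite -[in RHS](cat_take_drop n u) iter_subst_cat takel_cat //.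
by rewrite -{1}[n](size_takel (ltnW lt_nu)) size_iter_subst.
Qed.

Lemma iter_subst_cons (d : nat) (x : T) (u : seq T) :
  exists v, iter d (subst r) (x :: u) = iter d (fun y => head y (r y)) x :: v.
Proof.
elim: d => [|d [v IHd]] /=; first by exists u.
rewrite IHd /subst /=; case: (r _) (r_neq0 (iter d (fun y => head y (r y)) x)).
  by [].
by move=> y s _ /=; exists (s ++ flatten (map r v)).
Qed.

Variable N : nat.
Hypothesis first_idem : forall x,
  iter N (fun y => head y (r y)) (iter N (fun y => head y (r y)) x)
    = iter N (fun y => head y (r y)) x.

(* If the common prefix p of two consecutive levels does not get longer, then
   it is fixed, and the next letter evolves by the map x |-> first letter of
   r x alone, whose N-th iterate is idempotent. *)
Lemma take_iter_stable (j : nat) (u : seq T) :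
  take j (iter j (iter N (subst r)) u) = take j (iter j.+1 (iter N (subst r)) u).
Proof.
elim: j => [|j]; first by rewrite !take0.
set v := iter j _ u; rewrite (iterS j.+1) (iterS j) -/v.
set g := iter N (subst r) => IHj.
have gD : {morph g : a b / a ++ b} by move=> a b; apply: iter_subst_cat.
have gS a : size a <= size (g a) by apply: size_iter_subst.
(* If [v] has at most [j] letters, it is a prefix of [g v]: either they are equal, or [g v] is a
   proper extension, itself a prefix of [g (g v)]. *)
have [le_vj|lt_jv] := leqP (size v) j.
  rewrite take_oversize // in IHj.
  have [le_gj|lt_jg] := leqP (size (g v)) j.
    by rewrite take_oversize // in IHj; rewrite -IHj -IHj.
  rewrite -[in RHS](cat_take_drop j (g v)) -IHj gD takel_cat //.
have lt_jgv := leq_trans lt_jv (gS v).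
have [a [v' Ev]] : exists a v', v = take j v ++ a :: v'.
  case E: (drop j v) => [|a v'].
    by have := size_drop j v; rewrite E /=; move: lt_jv; lia.
  by exists a, v'; rewrite -E cat_take_drop.
have [b [y Eg]] : exists b y, g v = take j v ++ b :: y.
  case E: (drop j (g v)) => [|b y].
    by have := size_drop j (g v); rewrite E /=; move: lt_jgv; lia.
  by exists b, y; rewrite -E IHj cat_take_drop.
have szp := size_takel (ltnW lt_jv).
move: (take j v) Ev Eg szp => p Ev Eg szp.
have ggv : g (g v) = g p ++ g (b :: y) by rewrite Eg gD.
have gv : g v = g p ++ g (a :: v') by rewrite {1}Ev gD.
(* If [g p] is longer than [j], both sides are its first [j.+1] letters. Otherwise [g p = p], so [b]
   starts [g (a :: v')], and by idempotence it also starts [g (b :: y)]. *)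
have [lt_gp|le_gp] := ltnP j (size (g p)).
  by rewrite ggv gv !takel_cat.
have sz_gp : size (g p) = j by apply/eqP; rewrite eqn_leq le_gp -szp gS.
have [gpp gab] : g p = p /\ g (a :: v') = b :: y.
  move: (gv); rewrite Eg => E; split.
    by have := congr1 (take j) E; rewrite !take_size_cat.
  by have := congr1 (drop j) E; rewrite !drop_size_cat.
have [v1 E1] := iter_subst_cons N a v'.
have [v2 E2] := iter_subst_cons N b y.
rewrite ggv {1}Eg gpp !take_cat szp ltnNge leqnSn /= subSnn.
rewrite [g (b :: y)]E2 /= !take0; congr (_ ++ [:: _]).
have := gab; rewrite [g (a :: v')]E1 => -[<- _].
by rewrite first_idem.
Qed.

(** While the depth is at least [n.+1 * N], subtracting [N] keeps the prefix: those of levels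
    [n * N] and [n.+1 * N] agree, and a prefix of length [n] determines those of later levels. *)
Lemma depth_reduction (n d : nat) (u : seq T) : 0 < N ->
  exists2 e, e < n.+1 * N &
    take n (iter e (subst r) u) = take n (iter d (subst r) u).
Proof.
move=> N_gt0; elim/ltn_ind: d => d IHd.
have [lt_d|le_d] := ltnP d (n.+1 * N); first by exists d.
have [|e lt_e Ee] := IHd (d - N); first by move: le_d; rewrite mulSn; lia.
exists e => //; rewrite {}Ee.
have iterMN k : iter k (iter N (subst r)) u = iter (k * N) (subst r) u.
  by elim: k => //= k ->; rewrite mulSn iterD.
have := take_iter_stable n u; rewrite !iterMN => E.
have [k Ed] : exists k, d = k + n.+1 * N by exists (d - n.+1 * N); rewrite subnK.
have Ek : d - N = k + n * N by rewrite Ed mulSn; lia.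
by rewrite Ek Ed !(iterD k) -take_iter_subst E take_iter_subst.
Qed.

End Substitution.


(** By pigeonhole, the orbit of [x] enters within [s] steps a cycle of length at most [s]. This
    length divides s!, and s! steps suffice to reach the cycle. *)
Lemma iter_fact_idem (T : finType) (s : nat) (f : T -> T) (x : T) :
  #|T| <= s -> iter s`! f (iter s`! f x) = iter s`! f x.
Proof.
move=> le_Ts.
have [i [j [lt_ij le_js Eij]]] :
    exists i j, [/\ i < j, j <= s & iter i f x = iter j f x].
  have /injectivePn[i [j neq_ij Eij]] :
      ~~ injectiveb (fun i : 'I_(#|T|.+1) => iter i f x).
    by apply: contraL (leqnn #|T|.+1) => /injectiveP/leq_card; rewrite card_ord -ltnNge.
  have le_s (l : 'I_(#|T|.+1)) : l <= s by apply: leq_trans le_Ts; rewrite -ltnS.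
  case: (ltngtP i j) => [lt_ij|lt_ji|/val_inj Eq_ij]; last by rewrite Eq_ij eqxx in neq_ij.
    by exists i, j.
  by exists j, i.
have period k l : i <= l -> iter (k * (j - i) + l) f x = iter l f x.
  move=> le_il; elim: k => // k <-.
  have -> : k.+1 * (j - i) + l = (k * (j - i) + (l - i)) + j by lia.
  have -> : k * (j - i) + l = (k * (j - i) + (l - i)) + i by lia.
  by rewrite !iterD Eij.
have /dvdnP[k {1}->] : j - i %| s`! by apply: dvdn_fact; lia.
rewrite -iterD period //; apply: leq_trans (fact_geq s); lia.
Qed.

(** * Codes for the L-systems of bounded size *)

Lemma map_val_padded (l s : nat) (u : seq nat) : size u <= l ->
  all (leq^~ s) u ->
  exists t : l.-tuple 'I_s.+1, map val t = u ++ nseq (l - size u) 0.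
Proof.
move=> le_ul /allP us.
exists [tuple inord (nth 0 u i) | i < l].
apply: (@eq_from_nth _ 0) => [|i].
  by rewrite size_map size_tuple size_cat size_nseq subnKC.
rewrite size_map size_tuple => lt_il.
rewrite (nth_map ord0) ?size_tuple // (nth_mktuple _ _ (Ordinal lt_il)) /=.
rewrite inordK; last first.
  have [lt_iu|le_ui] := ltnP i (size u); last by rewrite nth_default.
  by rewrite ltnS us ?mem_nth.
rewrite nth_cat; case: ltnP => [//|le_ui]; rewrite nth_nseq nth_default //.
by case: ifP.
Qed.

(** This makes padding harmless: what it is cut into comes after the words of [P]. *)
Lemma reshape_cat (T : Type) (P : seq (seq T)) (sh : seq nat) (u : seq T) :
  reshape (shape P ++ sh) (flatten P ++ u) = P ++ reshape sh u.
Proof.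
elim: P => //= p P IHP.
by rewrite -catA take_size_cat // drop_size_cat // IHP.
Qed.
(** The head of [P] is the axiom and entry [i.+1] the rule of variable [i]. Binary output needs only
    one bit of the coding per variable. *)
Definition expand (n : nat) (P : seq (seq nat)) (bits : seq nat) (d : nat) :=
  map (nth 0 bits)
    (take n (iter d (subst (fun i => nth [::] P i.+1)) (head [::] P))).

(* The axiom and the rules are recovered by cutting the sequence a of letters
   into words of lengths given by b. *)
Definition decode (n s : nat)
    (x : s.+1.-tuple 'I_s.+1 * s.+1.-tuple 'I_s.+1 * s.+1.-tuple 'I_s.+1
         * 'I_(n.+1 * s`!)) : str :=
  let: (a, b, c, e) := x in
  expand n (reshape (map val b) (map val a)) (map val c) e.

Lemma leq_mem_sumn (x : nat) (u : seq nat) : x \in u -> x <= sumn u.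
Proof.
elim: u => //= y u IHu; rewrite inE => /predU1P[->|/IHu le_xu].
  exact: leq_addr.
exact: leq_trans le_xu (leq_addl _ _).
Qed.

Lemma fact_leq_exp (m s : nat) : m <= s -> m`! <= s ^ m.
Proof.
elim: m => // m IHm lt_ms; rewrite factS expnS.
exact: leq_mul lt_ms (IHm (ltnW lt_ms)).
Qed.

(** Rules are nonempty, so there are at most [s] variables, numbered by [enum_rank]. Hence [s.+1]
    entries, each at most [s], have room for the letters, for the [#|V|.+1] word lengths, and for
    the bits. *)
Lemma generates_decode (L : lsystem) (w : str) (s : nat) :
  generates L w -> ls_size L <= s -> all (gtn 2) w ->
  exists x, w = @decode (size w) s x.
Proof.
move=> [le_n Ew] le_Ls w2.
have szw : size w = ls_length L by rewrite Ew size_map size_takel.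
set V : finType := ls_vars L.
have rule_gt0 (A : V) : 0 < size (ls_rule A).
  by rewrite lt0n size_eq0 ls_rule_neq0.
have le_Vs : #|V| <= s.
  apply: leq_trans le_Ls; apply: leq_trans (leq_addl _ _).
  by rewrite -sum1_card; apply: leq_sum.
pose phi (A : V) : nat := enum_rank A.
have phi_lt A : phi A < #|V| by apply: ltn_ord.
have nth_phi (T : Type) (x0 : T) (f : V -> T) A :
    nth x0 [seq f B | B <- enum V] (phi A) = f A.
  by rewrite (nth_map A) -?cardE // nth_enum_rank.
pose P := map phi (ls_axiom L) :: [seq map phi (ls_rule A) | A <- enum V].
(* Variables coded by neither 0 nor 1 get the bit 0; they do not occur in the prefix that yields
   [w]. *)
pose bits : seq nat := [seq nat_of_bool (val (ls_coding A) == 1) | A <- enum V].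
have sumP : sumn (shape P) <= s.
  apply: leq_trans le_Ls; rewrite /= size_map leq_add2l.
  rewrite /shape -map_comp sumnE big_map big_enum /=.
  by apply: leq_sum => A _; rewrite size_map.
have [||a Ea] := @map_val_padded s.+1 s (flatten P).
  by rewrite size_flatten leqW.
  apply/allP => i /flattenP[p].
  have lt_phi u : i \in map phi u -> i <= s.
    by case/mapP=> A _ ->; apply: leq_trans le_Vs; apply: ltnW.
  by rewrite inE => /predU1P[->|/mapP[A _ ->]]; apply: lt_phi.
have [||b Eb] := @map_val_padded s.+1 s (shape P).
  by rewrite !size_map /= size_map -cardE.
  by apply/allP => i /leq_mem_sumn/leq_trans; apply.
have [||c Ec] := @map_val_padded s.+1 s bits.
  by rewrite size_map -cardE leqW.
  apply/allP => i /mapP[A _ ->]; case: eqP => //= _.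
  by apply: leq_trans le_Vs; apply/card_gt0P; exists A.
have [e lt_e Ee] := @depth_reduction V _ rule_gt0 _
  (fun A => iter_fact_idem (fun B => head B (ls_rule B)) A le_Vs)
  (size w) (ls_depth L) (ls_axiom L) (fact_gt0 s).
exists (a, b, c, Ordinal lt_e).
rewrite /decode Ea Eb Ec reshape_cat /expand /=.
rewrite -(@map_iter_subst _ (@ls_rule L) _ _ phi); last first.
  by move=> A; rewrite nth_cat size_map -cardE phi_lt nth_phi.
rewrite -map_take -map_comp Ee [in LHS]Ew -szw.
have Ebits A : nth 0 (bits ++ nseq (s.+1 - size bits) 0) (phi A)
    = (val (ls_coding A) == 1).
  by rewrite nth_cat size_map -cardE phi_lt nth_phi.
apply/eq_in_map => A inA; rewrite /= Ebits.
have bitE x : x < 2 -> x = (x == 1) by case: x => [|[]].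
by apply/bitE/(allP w2); rewrite Ew; apply: map_f; rewrite -szw.
Qed.

Lemma card_generated (W : seq str) (n s : nat) :
  uniq W -> all (fun w => (size w == n) && all (gtn 2) w) W ->
  all (fun w => ell w <= s) W -> size W <= s.+1 ^ (4 * s.+1) * n.+1.
Proof.
move=> uW /allP nW /allP lW.
(* A code consists of three tuples and a depth below (n + 1) s!, and s! is at most [s.+1 ^ s.+1]. *)
have le_D : (s.+1 ^ s.+1) ^ 3 * (n.+1 * s`!) <= s.+1 ^ (4 * s.+1) * n.+1.
  rewrite mulnCA mulnC leq_mul2r -expnM [4 * _]mulnC.
  have -> : s.+1 * 4 = s.+1 * 3 + s.+1 by lia.
  rewrite expnD leq_mul2l (leq_trans (fact_leq_exp (leqnSn s))) ?orbT //.
  by rewrite leq_pexp2l.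
apply: leq_trans le_D.
pose I := [seq @decode n s x | x : _].
have : {subset W <= I}.
  move=> w wW; have /andP[/eqP szw w2] := nW w wW.
  have := lW w wW; rewrite /ell; case: ex_minnP => m /asboolP[L gen <-] _ le_s.
  have [] := generates_decode gen le_s w2.
  by rewrite szw => x ->; apply: codom_f.
move=> /(uniq_leq_size uW)/leq_trans; apply.
by rewrite size_codom !card_prod !card_tuple !card_ord !expnS expn0 muln1 !mulnA.
Qed.

(** * Sparse words and their substrings *)

Definition sparse (w : str) : Prop :=
  forall p q, p < q -> nth 0 w p = 1 -> nth 0 w q = 1 -> 2 * p < q.

(* A window of length l starting at i >= l contains at most one 1, since the
   gap following a 1 at p >= l exceeds p. *)
Lemma sparse_nb_substrings (w : str) (l : nat) :
  sparse w -> all (gtn 2) w -> 0 < l -> nb_substrings w l <= 3 * l.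
Proof.
move=> spw /allP w2 l_gt0.
(* These are [2 * l + 1] words, at most [3 * l] because [l] is positive. *)
pose S := [seq take l (drop i w) | i <- iota 0 l]
  ++ nseq l 0 :: [seq nseq a 0 ++ 1 :: nseq (l - a.+1) 0 | a <- iota 0 l].
suff sub : {subset undup (substrings w l) <= S}.
  apply: leq_trans (uniq_leq_size (undup_uniq _) sub) _.
  by rewrite size_cat /= !size_map !size_iota; lia.
move=> u; rewrite mem_undup => /mapP[i]; rewrite mem_iota => /andP[_ lt_i] ->{u}.
have [lt_il|le_li] := ltnP i l.
  by rewrite mem_cat; apply/orP; left; apply/mapP; exists i; rewrite ?mem_iota.
rewrite mem_cat; apply/orP; right.
set u := take l _.
have szu : size u = l by rewrite size_takel // size_drop; lia.
have nthu a : a < l -> nth 0 u a = nth 0 w (i + a).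
  by move=> lt_al; rewrite nth_take // nth_drop.
have [/nthP|no1] := boolP (1 \in u); last first.
  suff -> : u = nseq l 0 by rewrite mem_head.
  rewrite -szu; apply/all_pred1P/allP => x xu /=.
  have : x < 2 by apply/w2/(mem_drop (n0 := i))/(mem_take (n0 := l)).
  by case: x xu => [|[|]] //; rewrite (negPf no1).
case/(_ 0) => a lt_a ua; rewrite szu in lt_a.
rewrite inE; apply/orP; right; apply/mapP; exists a; first by rewrite mem_iota.
apply: (@eq_from_nth _ 0); first by rewrite size_cat /= !size_nseq; lia.
move=> b; rewrite szu => lt_b.
have only1 : b != a -> nth 0 u b = 0.
  move=> neq_ba.
  have : nth 0 u b < 2.
    by apply/w2/(mem_drop (n0 := i))/(mem_take (n0 := l))/mem_nth; rewrite szu.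
  case E: (nth 0 u b) => [|[|]] // _; exfalso.
  rewrite !nthu // in E ua.
  case: (ltngtP a b) neq_ba => // [lt_ab|lt_ba] _.
    by have := spw (i + a) (i + b); rewrite ltn_add2l => /(_ lt_ab ua E); lia.
  by have := spw (i + b) (i + a); rewrite ltn_add2l => /(_ lt_ba E ua); lia.
rewrite nth_cat size_nseq; case: (ltngtP b a) only1 => [lt_ba|lt_ab|->] only1.
- by rewrite only1 // nth_nseq lt_ba.
- rewrite only1 //; have -> : b - a = (b - a.+1).+1 by lia.
  by rewrite /= nth_nseq if_same.
- by rewrite subnn.
Qed.

Lemma sparse_delta (R : realType) (w : str) :
  sparse w -> all (gtn 2) w -> (delta R w <= 3%:R)%R.
Proof.
move=> spw w2; rewrite /delta big_nat_cond.
elim/big_ind: _ => [|x y x3 y3|l /andP[/andP[l_gt0 _] _]].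
- by rewrite ler0n.
- by rewrite ge_max x3.
- by rewrite ler_pdivrMr ?ltr0n // -natrM ler_nat sparse_nb_substrings.
Qed.

(* The 1s are at one position in [4 ^ i, 2 * 4 ^ i) for each i < k. *)
Fixpoint sparse_words (k : nat) : seq str :=
  if k is k'.+1 then
    [seq u ++ (nseq r 0 ++ 1 :: nseq (3 * 4 ^ k' - r.+1) 0)
    | u <- sparse_words k', r <- iota 0 (4 ^ k')]
  else [:: [:: 0]].

(** The exponent comes from the product of the [4 ^ i] for [i < k]. *)
Lemma size_sparse_words (k : nat) : size (sparse_words k) = 2 ^ (k * k.-1).
Proof.
elim: k => // k IHk; rewrite size_allpairs size_iota IHk -(expnM 2 2) -expnD.
by congr (2 ^ _); case: k {IHk} => //= k; lia.
Qed.

(** The last clause carries the induction: earlier 1s lie before half of [4 ^ k], so a new 1 at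
    [4 ^ k] or later is far enough from them. *)
Lemma sparse_words_prop (k : nat) (w : str) : w \in sparse_words k ->
  [/\ size w = 4 ^ k, all (gtn 2) w, sparse w &
      forall p, nth 0 w p = 1 -> 2 * p < 4 ^ k].
Proof.
elim: k w => [|k IHk] w.
  rewrite inE => /eqP->.
  have no1 p : nth 0 [:: 0] p = 1 -> False by case: p => [|[|]].
  by split=> // [p q _ /no1|p /no1].
case/allpairsP => -[u r] /= [/IHk[szu u2 spu lt_u]]; rewrite mem_iota /= => lt_r ->.
have exp_gt0 : 0 < 4 ^ k by rewrite expn_gt0.
have ones p : nth 0 (u ++ (nseq r 0 ++ 1 :: nseq (3 * 4 ^ k - r.+1) 0)) p = 1 ->
    p < 4 ^ k /\ nth 0 u p = 1 \/ p = 4 ^ k + r.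
  rewrite nth_cat szu; case: ltnP => [|le_p]; first by left.
  rewrite nth_cat size_nseq; case: ltnP => [lt_pr|le_r].
    by rewrite nth_nseq lt_pr.
  case E: (p - _ - _) => [|m] /=; first by right; lia.
  by rewrite nth_nseq if_same.
split.
- by rewrite size_cat /= size_cat /= !size_nseq szu expnS; lia.
- by rewrite !all_cat u2 /= !all_nseq /= !orbT.
- move=> p q lt_pq /ones[[lt_p up]|Ep] /ones[[lt_q uq]|Eq].
  + exact: spu.
  + by have := lt_u p up; lia.
  + by lia.
  + by lia.
- move=> p /ones[[lt_p up]|->]; rewrite expnS; last by lia.
  by have := lt_u p up; lia.
Qed.

Lemma uniq_sparse_words (k : nat) : uniq (sparse_words k).
Proof.
elim: k => // k IHk; apply: allpairs_uniq => //; first exact: iota_uniq.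
move=> [u r] [v t] /allpairsP[[u' r'] [/= uW _ [-> ->]]].
move=> /allpairsP[[v' t'] [/= vW _ [-> ->]]] {u r v t} /eqP.
have [szu _ _ _] := sparse_words_prop uW; have [szv _ _ _] := sparse_words_prop vW.
(* The first 1 of the appended block recovers its parameter. *)
rewrite eqseq_cat ?szu // => /andP[/eqP-> /eqP/(congr1 (index 1))].
by rewrite !index_cat !mem_nseq !andbF /= !size_nseq !addn0 => ->.
Qed.

(** * Words that need large L-systems *)

Lemma mul8_leq_expn2 (j : nat) : 5 < j -> 8 * (j + 2) <= 2 ^ j.
Proof.
elim: j => // j IHj; rewrite ltnS leq_eqVlt => /predU1P[<- //|/IHj].
by rewrite expnS; lia.
Qed.

(** Otherwise the count gives [k (k - 1) <= 4 (j + 1) (k + 1) + 2 k + 1], contradicting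
    [8 (j + 2) <= k]. The choice [k = 2 ^ j] lets [2 ^ j.+1] bound [k.+1]. *)
Lemma hard_sparse_word (j : nat) : 5 < j ->
  exists2 w, w \in sparse_words (2 ^ j) & 2 ^ j < ell w.
Proof.
move=> lt5j; set k := 2 ^ j.
have le_jk : 8 * (j + 2) <= k by apply: mul8_leq_expn2.
case: (boolP (all (fun w => ell w <= k) (sparse_words k))); last first.
  by case/allPn => w wW; rewrite -ltnNge; exists w.
move=> /card_generated-/(_ (4 ^ k) (uniq_sparse_words k)) le_W.
have : 2 ^ (k * k.-1) <= k.+1 ^ (4 * k.+1) * (4 ^ k).+1.
  rewrite -size_sparse_words; apply: le_W.
  by apply/allP => w /sparse_words_prop[/eqP-> -> _ _].
have le_k : k.+1 <= 2 ^ j.+1 by rewrite expnS -/k; lia.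
have le_n : (4 ^ k).+1 <= 2 ^ (2 * k).+1.
  rewrite expnS (expnM 2 2) mulSn mul1n -addn1 leq_add2l.
  by rewrite expn_gt0.
have le_kexp : k.+1 ^ (4 * k.+1) <= (2 ^ j.+1) ^ (4 * k.+1) by rewrite leq_exp2r.
move=> /leq_trans/(_ (leq_mul le_kexp le_n)).
rewrite -expnM -expnD leq_exp2l //; nia.
Qed.

Local Open Scope classical_set_scope.
Local Open Scope ring_scope.

Theorem theorem4 (R : realType) :
  exists (F : set str) (C : R),
    [/\ infinite_set F,
        (forall N : nat, exists2 w : str, F w & (N <= size w)%N),
        0 < C &
        forall w : str, F w -> (2 <= size w)%N ->
          C * delta R w * ln ((size w)%:R : R) <= (ell w)%:R].
Proof.
pose F : set str := [set w | exists2 j, (5 < j)%N &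
  w \in sparse_words (2 ^ j) /\ (2 ^ j < ell w)%N].
have F_large N : exists2 w : str, F w & (N <= size w)%N.
  (* Adding 6 ensures [5 < j]; then [N <= 2 ^ (N + 6) <= 4 ^ (2 ^ (N + 6))]. *)
  have [w wW lt_w] := @hard_sparse_word (N + 6) (leq_addl _ _).
  exists w; first by exists (N + 6)%N; rewrite ?leq_addl.
  have [-> _ _ _] := sparse_words_prop wW.
  apply: leq_trans (leq_addr 6 N) _.
  have lt_exp (b m : nat) : (1 < b)%N -> (m <= b ^ m)%N.
    by move=> /ltn_expl/ltnW.
  by apply: leq_trans (lt_exp 2%N _ _) (lt_exp 4%N _ _).
have ln4_gt0 : 0 < ln (4%:R : R) by rewrite ln_gt0 // ltr1n.
(* As [delta] is at most 3 and the logarithm of the length is [2 ^ j * ln 4], this constant makes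
   the left side at most [2 ^ j]. *)
exists F, (3%:R * ln 4%:R)^-1; split => //.
- move=> /finite_seqP[s Fs].
  have [w Fw] := F_large (\max_(u <- s) size u).+1.
  by rewrite ltnNge leq_bigmax_seq //; move: Fw; rewrite Fs.
- by rewrite invr_gt0 mulr_gt0.
move=> w [j _ [wW lt_ell]] _.
have [-> w2 spw _] := sparse_words_prop wW.
apply: le_trans (_ : (2 ^ j)%:R <= _); last by rewrite ler_nat ltnW.
rewrite natrX lnXn ?ltr0n // -[ln _ *+ _]mulr_natr.
have -> : (3%:R * ln 4%:R)^-1 * delta R w * (ln 4%:R * (2 ^ j)%:R)
    = delta R w / 3%:R * (2 ^ j)%:R by field; rewrite gt_eqF.
by rewrite ler_piMl // ler_pdivrMr ?ltr0n // mul1r sparse_delta.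
Qed.
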